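(* Every hereditary word property is testable with perfect completeness.
   Context: Words are finite sequences over $\{0,1\}$; a word property is a collection of words. A word property $\mathcal{P}$ is hereditary if for each $\boldsymbol{w}\in\mathcal{P}$ every (not necessarily contiguous) subsequence of $\boldsymbol{w}$ also belongs to $\mathcal{P}$. For $\boldsymbol{u},\boldsymbol{w}\in\{0,1\}^n$ let $d_1(\boldsymbol{w},\boldsymbol{u})=\frac1n\sum_{i=1}^n|w_i-u_i|$ and $d_1(\boldsymbol{w},\mathcal{P})=\min_{\boldsymbol{u}\in\mathcal{P}\cap\{0,1\}^n}d_1(\boldsymbol{w},\boldsymbol{u})$ (equal to $\infty$ if $\mathcal{P}\cap\{0,1\}^n=\emptyset$). For a word $\boldsymbol{w}$ of length $n$ and $\ell\le n$, $\mathrm{sub}(\ell,\boldsymbol{w})$ is the random word $(w_{i_1},\dots,w_{i_\ell})$, where $\{i_1<\dots<i_\ell\}$ is chosen uniformly among all $\ell$-element subsets of $\{1,\dots,n\}$. A word property $\mathcal{P}$ is testable if there is another word property $\mathcal{P}'$ (a test property for $\mathcal{P}$) such that: (Completeness) for every $\boldsymbol{w}\in\mathcal{P}$ of length $n$ and every $\ell\in\{1,\dots,n\}$, $\mathbb{P}(\mathrm{sub}(\ell,\boldsymbol{w})\in\mathcal{P}')\ge\frac23$; (Soundness) for every $\varepsilon>0$ there is an $\ell(\varepsilon)\ge1$ such that if $\boldsymbol{w}\in\{0,1\}^n$ satisfies $d_1(\boldsymbol{w},\mathcal{P})\ge\varepsilon$, then $\mathbb{P}(\mathrm{sub}(\ell,\boldsymbol{w})\in\mathcal{P}')\le\frac13$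 for all $\ell(\varepsilon)\le\ell\le n$. It is testable with perfect completeness if this holds with the probability bound in Completeness being $1$ instead of $\frac23$. *)

(* Defs.v *)
From mathcomp Require Import all_boot all_order all_algebra.
From mathcomp Require Import boolp classical_sets reals constructive_ereal.

Set Implicit Arguments.
Unset Strict Implicit.
Unset Printing Implicit Defensive.

Import Order.TTheory GRing.Theory Num.Theory.
Local Open Scope classical_set_scope.
Local Open Scope ring_scope.

Definition word : Type := seq bool.

Definition word_property : Type := set word.

Definition hereditary (P : word_property) : Prop :=
  forall w : word, P w -> forall u : word, subseq u w -> P u.

(* For n = 0 this is 0 (as 0^-1 = 0); testability below never depends on it. *)
Definition d1 (R : realType) (n : nat) (w u : n.-tuple bool) : R :=
  n%:R^-1 * \sum_(i < n) `|(tnth w i)%:R - (tnth u i)%:R|.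

Definition d1_property (R : realType) (n : nat) (w : n.-tuple bool)
    (P : word_property) : \bar R :=
  \big[Order.min/+oo%E]_(u : n.-tuple bool | `[< P u >]) (d1 R w u)%:E.

(* [enum I] lists I in increasing order. *)
Definition subword (n : nat) (w : n.-tuple bool) (I : {set 'I_n}) : word :=
  [seq tnth w i | i <- enum I].

Definition uniform_prob (R : realType) (T : finType) (A : {set T})
    (E : set T) : R :=
  #|[set x in A | `[< E x >]]|%:R / #|A|%:R.

(* The probability that sub(l, w) lies in Q; meaningful for l <= n. *)
Definition sub_prob (R : realType) (l n : nat) (w : n.-tuple bool)
    (Q : word_property) : R :=
  uniform_prob R [set I : {set 'I_n} | #|I| == l]%SET
    [set I | Q (subword w I)].

Definition completeness (R : realType) (c : R) (P Q : word_property) : Prop :=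
  forall (n : nat) (w : n.-tuple bool), P w ->
  forall l : nat, (1 <= l <= n)%N -> c <= sub_prob R l w Q.

Definition soundness (R : realType) (P Q : word_property) : Prop :=
  forall eps : R, 0 < eps ->
  exists2 l0 : nat, (1 <= l0)%N &
    forall (n : nat) (w : n.-tuple bool), (eps%:E <= d1_property R w P)%E ->
    forall l : nat, (l0 <= l <= n)%N -> sub_prob R l w Q <= 1 / 3.

Definition testable_with (R : realType) (c : R) (P : word_property) : Prop :=
  exists Q : word_property, completeness c P Q /\ soundness R P Q.

Definition testable (R : realType) (P : word_property) : Prop :=
  testable_with (2 / 3 : R) P.

Definition testable_perfect_completeness (R : realType) (P : word_property)
    : Prop :=
  testable_with (1 : R) P.

(* Main.v *)
Require Import Defs.
From mathcomp Require Import all_boot all_order all_algebra.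
From mathcomp Require Import boolp classical_sets reals constructive_ereal.
From mathcomp Require Import zify.

Set Implicit Arguments.
Unset Strict Implicit.
Unset Printing Implicit Defensive.

Import Order.TTheory GRing.Theory Num.Theory.

(** A hereditary property [P] serves as its own test property. Completeness is
    then immediate, as samples of [w] are subsequences of [w]. Soundness needs:
    if [w] is far from [P], then a random sample of [w] is unlikely to be in
    [P]. As [P] is hereditary, it is enough that the sample contains one fixed
    word [g] outside [P].

    Sampling. Suppose that [w] splits into consecutive pieces, one for each
    letter of [g], such that the piece of the letter [a] has at least [q]
    occurrences of [a] ([heavy]). A sample that hits all these occurrence sets
    contains [g]. A random [l]-set misses a given [q]-set of positions with
    probability at most [n / (l * q)], so a union bound ([card_miss]) shows that
    the sample contains [g] with high probability once [q] is a fixed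
    fraction of [n], the length of [g] is bounded, and [l] is large.

    Finding [g]. If all words are in [P], nothing is far from [P]. Otherwise fix
    a word [f] outside [P]. Cut [w] into a bounded number [k] of blocks of
    comparable lengths, and call a block mixed if both letters are frequent in it.
    - If at least [size f] blocks are mixed, then they can carry the letters of
      [f] one by one, and [g := f] works ([heavy_mixed]).
    - Otherwise, replacing each block by its majority letter yields a word [u]
      close to [w]: few blocks are mixed, and the others have few minority
      letters ([hamming_smooth]). So [u] is not in [P]. Now [u] is a blow-up of
      one of the [2 ^ k] patterns of majority letters, and since there are
      finitely many patterns there is a single [M] such that a pattern whose
      [M]-fold blow-up is in [P] has all its blow-ups in [P]
      ([blowup_compactness]). Hence the [M]-fold blow-up of the pattern of [u]
      is outside [P], and it is a suitable [g] because each block has many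
      copies of its majority letter ([heavy_blowup]).

    The order of choices matters: [f] and the distance determine [k], which
    determines [M], which determines the fraction [q / n]. *)

Local Open Scope nat_scope.

(** * Abundant occurrences of a word *)

(** A splitting of [w] that certifies many occurrences of [f]. Splitting rather
    than counting occurrences makes the notion compatible with concatenation,
    and gives one independent condition per letter for the union bound. *)
Fixpoint heavy (q : nat) (f w : word) : Prop :=
  if f is a :: f' then
    exists w1 w2, [/\ w = w1 ++ w2, q <= count_mem a w1 & heavy q f' w2]
  else True.

Lemma heavy_cat q f g v w :
  heavy q f v -> heavy q g w -> heavy q (f ++ g) (v ++ w).
Proof.
elim: f v => [|a f IHf] v /=.
  move=> _; case: g => [//|b g] [w1 [w2 [-> cw1 hw2]]].
  exists (v ++ w1), w2; split; rewrite ?catA // count_cat.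
  exact: leq_trans cw1 (leq_addl _ _).
move=> [v1 [v2 [-> cv1 hv2]]] hw; exists v1, (v2 ++ w).
by split; rewrite ?catA //; exact: IHf.
Qed.

Lemma count_prefix (a : bool) (w : word) q :
  q <= count_mem a w -> exists w1 w2, w = w1 ++ w2 /\ count_mem a w1 = q.
Proof.
elim: w q => [|b w IHw] q /=.
  by rewrite leqn0 => /eqP->; exists [::], [::].
case: q => [|q] le_q; first by exists [::], (b :: w).
have [|w1 [w2 [-> cw1]]] := IHw (q.+1 - (b == a)).
  by move: le_q; case: (b == a) => /=; lia.
by exists (b :: w1), w2; split => //=; move: le_q cw1; case: (b == a) => /=; lia.
Qed.

Lemma heavy_nseq q M a w : M * q <= count_mem a w -> heavy q (nseq M a) w.
Proof.
elim: M w => [//|M IHM] w; rewrite mulSn => le_w /=.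
have [|w1 [w2 [def_w cw1]]] := @count_prefix a w q; first by lia.
exists w1, w2; split; rewrite ?cw1 //; apply: IHM.
by move: le_w; rewrite def_w count_cat cw1 leq_add2l.
Qed.

(** The occurrence sets of a heavy splitting, as sets of positions: every
    transversal of them spells [f]. The word is read at the end of an arbitrary
    prefix [p] so that the induction needs no shift of positions. *)
Lemma heavy_positions q f p w : heavy q f w ->
  exists As : seq (seq nat),
    [/\ size As = size f,
        forall A, A \in As -> [/\ uniq A, q <= size A &
          {in A, forall i, size p <= i < size (p ++ w)}]
      & forall xs, size xs = size As ->
          (forall j, j < size As -> nth 0 xs j \in nth [::] As j) ->
          sorted ltn xs /\ map (nth false (p ++ w)) xs = f].
Proof.
elim: f p w => [|a f IHf] p w /=.
  by move=> _; exists [::]; split=> // -[].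
move=> [w1 [w2 [-> cw1 hw2]]].
have [As [szAs AsP xsP]] := IHf (p ++ w1) w2 hw2.
pose A1 := [seq i <- iota (size p) (size w1) | nth false (p ++ w1 ++ w2) i == a].
have A1P i : i \in A1 -> size p <= i < size p + size w1
    /\ nth false (p ++ w1 ++ w2) i = a.
  by rewrite mem_filter mem_iota => /andP[/eqP].
exists (A1 :: As); split; first by rewrite /= szAs.
- move=> A; rewrite inE => /predU1P[->|/AsP[uA qA Ai]].
    split; first by rewrite filter_uniq ?iota_uniq.
      suff -> : size A1 = count_mem a w1 by [].
      have -> : count_mem a w1 = count_mem a (mkseq (nth false w1) (size w1)).
        by rewrite mkseq_nth.
      rewrite size_filter count_map -[X in iota X _]addn0 iotaDl count_map.
      apply: eq_in_count => i.
      rewrite mem_iota /= add0n => lti.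
      by rewrite nth_cat ltnNge leq_addr /= addKn nth_cat lti.
    by move=> i /A1P[]; rewrite !size_cat; lia.
  by split=> // i /Ai; rewrite !size_cat; lia.
move=> [//|x xs] /= [szxs] xs_in.
have [x_lt x_a] := A1P _ (xs_in 0 isT).
have [|sxs <-] := xsP xs szxs; first by move=> j; exact: (xs_in j.+1).
rewrite catA; rewrite catA in x_a; split; last by rewrite x_a.
rewrite path_min_sorted //; apply/allP=> y /(nthP 0)[j ltj <-] /=.
rewrite szxs in ltj.
have [_ _ /(_ _ (xs_in j.+1 ltj))] := AsP _ (mem_nth [::] ltj).
case/andP=> + _; rewrite size_cat; case/andP: x_lt => _; exact: leq_trans.
Qed.

Lemma subseq_sorted_ltn (s t : seq nat) :
  sorted ltn s -> sorted ltn t -> {subset s <= t} -> subseq s t.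
Proof.
move=> ss st sub.
have -> : s = [seq x <- t | x \in s].
  apply: (irr_sorted_eq ltn_trans ltnn) => //.
    exact: sorted_filter ltn_trans _ _ st.
  by move=> x; rewrite mem_filter; case: (boolP (x \in s)) => //= /sub ->.
exact: filter_subseq.
Qed.

(** A sample that meets every occurrence set contains a transversal of them,
    listed in increasing order, hence [f]. *)
Lemma subword_hits q f n (w : n.-tuple bool) : heavy q f w ->
  exists As : seq {set 'I_n},
    [/\ size As = size f, forall A, A \in As -> q <= #|A|
      & forall I : {set 'I_n}, (forall A, A \in As -> ~~ [disjoint I & A]) ->
          subseq f (subword w I)].
Proof.
move=> /(@heavy_positions _ _ [::])[As [szAs AsP xsP]].
rewrite /= size_tuple in AsP xsP.
pose toset (A : seq nat) := [set i : 'I_n | val i \in A]%SET.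
exists (map toset As); split; first by rewrite size_map.
  move=> _ /mapP[A /AsP[uA qA Alt] ->]; apply: leq_trans qA _.
  have -> : toset A = [set i : 'I_n | i \in pmap insub A]%SET.
    by apply/setP=> i; rewrite !inE mem_pmap_sub.
  have Aall : all (fun i => i < n) A by apply/allP=> i /Alt.
  rewrite cardsE (card_uniqP (pmap_sub_uniq _ uA)) size_pmap_sub.
  by rewrite (eqP (_ : count _ A == size A)) -?all_count.
move=> I hit; pose J := [seq val i | i <- enum I].
have sJ : sorted ltn J.
  apply: (subseq_sorted ltn_trans _ (iota_ltn_sorted 0 n)).
  rewrite -val_enum_ord; apply: map_subseq.
  by rewrite enumT; exact: filter_subseq.
pose pt j := head 0 [seq i <- nth [::] As j | i \in J].
have ptP j : j < size As -> pt j \in nth [::] As j /\ pt j \in J.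
  move=> ltj; have /hit : toset (nth [::] As j) \in map toset As.
    exact/map_f/mem_nth.
  rewrite -setI_eq0 => /set0Pn[i]; rewrite !inE => /andP[iI iA].
  have : val i \in [seq i <- nth [::] As j | i \in J].
    by rewrite mem_filter iA map_f ?mem_enum.
  rewrite /pt; case def_s: [seq _ <- _ | _] => [//|x s] _.
  have : x \in [seq i <- nth [::] As j | i \in J] by rewrite def_s mem_head.
  by rewrite mem_filter => /andP[].
have [|j ltj|sxs <-] := xsP (mkseq pt (size As)).
- by rewrite size_mkseq.
- by rewrite nth_mkseq //; case: (ptP j ltj).
have -> : subword w I = map (nth false w) J.
  by rewrite /subword -map_comp; apply: eq_map => i; rewrite /= (tnth_nth false).
apply/map_subseq/subseq_sorted_ltn => // x /mapP[j].
by rewrite mem_iota /= => /ptP[_ ?] ->.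
Qed.

(** * Samples rarely miss an abundant word *)

(** The left side counts the [l.+1]-subsets of an [m + q]-set that meet a given
    [q]-subset in exactly one element. *)
Lemma bin_sub_ge q m l : q * 'C(m, l) <= 'C(m + q, l.+1).
Proof.
elim: q => [//|q IHq]; rewrite mulSn addnS binS addnC leq_add //.
by rewrite leq_bin2l ?leq_addr.
Qed.

(** Among the [l]-subsets of an [n]-set, a fraction at most [n / (l * q)] avoids a
    given [q]-set: the avoiding ones are outnumbered, up to this ratio, by those
    that meet the [q]-set in a single element. *)
Lemma bin_miss q n l : q <= n -> l * q * 'C(n - q, l) <= n * 'C(n, l).
Proof.
case: l => [|l] le_qn; first by rewrite !mul0n.
have := bin_sub_ge q (n - q) l; rewrite subnK // => le1.
have := mul_bin_left (n - q) l => eq1.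
have : (n - q - l) * 'C(n - q, l) <= n * 'C(n - q, l) by rewrite leq_mul2r; lia.
by nia.
Qed.

(** Union bound over the occurrence sets. *)
Lemma card_miss q f n (w : n.-tuple bool) l : q <= n -> heavy q f w ->
  l * q * #|[set I : {set 'I_n} | (#|I| == l) && ~~ subseq f (subword w I)]%SET|
    <= size f * (n * 'C(n, l)).
Proof.
move=> le_qn /subword_hits[As [<- AsP hit]].
set B := [set _ | _]%SET.
pose miss (A : {set 'I_n}) := [set I : {set 'I_n} | I \subset ~: A & #|I| == l]%SET.
have sub : (B \subset \bigcup_(A <- As) miss A)%SET.
  apply/fintype.subsetP=> I; rewrite inE => /andP[/eqP cI].
  have [/hasP[A AsA disj] _|/hasPn nohit] :=
    boolP (has (fun A : {set 'I_n} => [disjoint I & A]) As).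
    by rewrite (big_rem A) //= !inE -finset.disjoints_subset disj cI eqxx.
  by rewrite hit.
have card_bigcup s : #|\bigcup_(A <- s) miss A|%SET <= \sum_(A <- s) #|miss A|.
  elim: s => [|A s IHs]; first by rewrite !big_nil cards0.
  rewrite !big_cons; apply: leq_trans (leq_card_setU _ _) _.
  by rewrite leq_add2l.
apply: leq_trans (_ : l * q * \sum_(A <- As) #|miss A| <= _).
  by rewrite leq_mul2l (leq_trans (subset_leq_card sub) (card_bigcup _)) orbT.
rewrite big_distrr /= -sum1_size big_distrl /= big_seq [leqRHS]big_seq.
apply: leq_sum => A AsA; rewrite mul1n; apply: leq_trans (bin_miss _ le_qn).
rewrite leq_mul2l; apply/orP; right.
rewrite cards_draws leq_bin2l // -[n in n - q]card_ord -(cardsC A).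
by have := AsP A AsA; lia.
Qed.

(** * Smoothing the blocks of a word *)

Definition majority (v : word) : bool := count_mem false v <= count_mem true v.

Definition mixed (q : nat) (v : word) : bool :=
  (q <= count_mem false v) && (q <= count_mem true v).

Definition hamming (w u : word) : nat :=
  count (fun p => p.1 != p.2) (zip w u).

Definition blowup (M : nat) (t : word) : word := flatten [seq nseq M a | a <- t].

Lemma count_compl (a : bool) v : count_mem a v + count_mem (~~ a) v = size v.
Proof. by elim: v => //= b v IHv; case: a b IHv => [] [] /=; lia. Qed.

(** Each letter of [f] is found in its own mixed block, whichever letter it is. *)
Lemma heavy_mixed q (W : seq word) f :
  size f <= count (mixed q) W -> heavy q f (flatten W).
Proof.
elim: W f => [|v W IHW] [|a f] //=.
have [/andP[q0 q1]|_] := boolP (mixed q v); rewrite ?add0n => le_f.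
  by exists v, (flatten W); split; [|case: a le_f|exact: IHW].
exact: (@heavy_cat q [::] _ v _ I (IHW (a :: f) le_f)).
Qed.

(** The majority letter fills at least half of its block. *)
Lemma heavy_blowup q M (W : seq word) :
  (forall v, v \in W -> 2 * (M * q) <= size v) ->
  heavy q (blowup M (map majority W)) (flatten W).
Proof.
elim: W => //= v W IHW Wq; apply: heavy_cat.
  apply: heavy_nseq; have := Wq v (mem_head _ _).
  rewrite -(count_compl true v) /majority /=.
  by case: (leqP (count_mem false v)) => /=; lia.
by apply: IHW => x Wx; apply: Wq; rewrite inE Wx orbT.
Qed.

Definition smooth (W : seq word) : word :=
  flatten [seq nseq (size v) (majority v) | v <- W].

Lemma size_smooth W : size (smooth W) = size (flatten W).
Proof.
by rewrite !size_flatten /shape -map_comp; congr sumn; apply: eq_map => v /=;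
   rewrite size_nseq.
Qed.

Lemma smooth_subseq W n : (forall v, v \in W -> size v <= n) ->
  subseq (smooth W) (blowup n (map majority W)).
Proof.
elim: W => //= v W IHW Wn; apply: cat_subseq; last first.
  by apply: IHW => x Wx; apply: Wn; rewrite inE Wx orbT.
by rewrite -(subnKC (Wn v (mem_head _ _))) nseqD prefix_subseq.
Qed.

Lemma hamming_nseq v a : hamming v (nseq (size v) a) = count_mem (~~ a) v.
Proof.
rewrite /hamming; elim: v => //= b v ->.
by case: a b => [] [].
Qed.

(** A block that is not mixed has fewer than [q] minority letters; a mixed block
    is charged its whole length. *)
Lemma hamming_smooth q b (W : seq word) :
  (forall v, v \in W -> size v <= 2 * b) ->
  hamming (flatten W) (smooth W) <= size W * q + count (mixed q) W * (2 * b).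
Proof.
elim: W => //= v W IHW Wb.
have /IHW : forall x, x \in W -> size x <= 2 * b.
  by move=> x Wx; apply: Wb; rewrite inE Wx orbT.
have := Wb v (mem_head _ _).
rewrite {2}/hamming /smooth /= zip_cat ?size_nseq // count_cat.
rewrite -/(hamming _ _) hamming_nseq -/(smooth _) -/(hamming _ _).
rewrite -{1}(count_compl true v) /majority /mixed /=.
case: (leqP (count_mem false v)) => /=;
case: (leqP q (count_mem false v)) => /=;
case: (leqP q (count_mem true v)) => /=; rewrite ?mulnDl ?mul1n mulSn; lia.
Qed.

Lemma equipartition b k (w : word) :
  k * b <= size w <= k * (2 * b) ->
  exists W : seq word, [/\ size W = k, flatten W = w &
    forall v, v \in W -> b <= size v <= 2 * b].
Proof.
elim: k w => [|k IHk] w.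
  by rewrite !mul0n leqn0 => /andP[_ /eqP/size0nil->]; exists [::].
(* The longest first block that leaves enough letters for the [k] others. *)
rewrite !mulSn => w_sz; pose x := minn (2 * b) (size w - k * b).
have [|W [szW fW WP]] := IHk (drop x w).
  rewrite size_drop /x; move: w_sz; have -> : k * (2 * b) = 2 * (k * b) by lia.
  by lia.
exists (take x w :: W); split; rewrite /= ?szW ?fW ?cat_take_drop //.
move=> v; rewrite inE => /predU1P[->|/WP//].
by rewrite size_take /x; move: w_sz; case: ltnP; lia.
Qed.

(** * Words far from a hereditary property *)

(** There are finitely many patterns of length [k], and blow-ups of a pattern
    form an increasing chain for the subsequence order: if some blow-up of the
    pattern leaves [P], all larger ones are outside [P] as well. *)
Lemma blowup_compactness (P : word_property) k : hereditary P ->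
  exists2 M, 0 < M & forall t, size t = k ->
    P (blowup M t) -> forall n, P (blowup n t).
Proof.
move=> hP.
have blowupS M N t : M <= N -> subseq (blowup M t) (blowup N t).
  move=> le_MN; elim: t => //= a t IHt; apply: cat_subseq IHt.
  by rewrite -(subnKC le_MN) nseqD prefix_subseq.
have /choice[g gP] (t : k.-tuple bool) :
    exists M, P (blowup M t) -> forall n, P (blowup n t).
  have [Pt|] := pselect (forall n, P (blowup n t)); first by exists 0.
  by move/existsNP => [M nPM]; exists M.
exists (\max_t g t).+1 => // t /eqP szt Pt.
apply: (gP (Tuple szt)); apply: hP Pt _ _; apply: blowupS.
exact: leqW (leq_bigmax (Tuple szt)).
Qed.

(** The structural core: if the distance from [w] to [P] exceeds [1 / E], then the
    obstruction [g] has bounded length and linear weight. There are fewer than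
    [size f] mixed blocks, each of length at most [2 * n / k], and [k] is chosen
    so that they contribute at most [n / (2 * E)] to the Hamming distance. The
    factors of [D] make [k * q] at most [n / (2 * E)] and leave room for
    [M] disjoint groups of [q] majority letters in half a block. *)
Lemma heavy_obstruction (P : word_property) f E : hereditary P -> ~ P f ->
    0 < E ->
  exists r D, 0 < D /\ forall w : word, D <= size w ->
    (forall u, size u = size w -> P u -> size w < E * hamming w u) ->
    exists g, [/\ ~ P g, size g <= r & heavy (size w %/ D) g w].
Proof.
move=> hP nPf E_gt0.
(* The successor keeps [k] positive when [f] is empty. *)
pose k := 4 * E * (size f).+1.
have k_gt0 : 0 < k by rewrite /k; lia.
have [M M_gt0 MP] := blowup_compactness k hP.
exists (size f + k * M), (2 * k * E * M); split; first by rewrite !muln_gt0; lia.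
move=> w; set n := size w; set D := 2 * k * E * M; set q := n %/ D => le_Dn far.
have D_gt0 : 0 < D by rewrite !muln_gt0; lia.
pose b := n %/ k.
have le_kb : k * b <= n by rewrite mulnC leq_trunc_div.
have b_gt0 : 0 < b.
  rewrite divn_gt0 //; apply: leq_trans le_Dn.
  have -> : D = k * (2 * (E * M)) by rewrite /D; lia.
  by rewrite leq_pmulr // !muln_gt0 E_gt0.
have lt_kb : n < k * b.+1 by rewrite mulnC ltn_ceil.
have le_qD : q * D <= n by exact: leq_trunc_div.
have [|W [szW def_w WP]] := @equipartition b k w; first by rewrite -/n; nia.
have [few|many] := ltnP (count (mixed q) W) (size f); last first.
  exists f; split=> //; first exact: leq_addr.
  by rewrite -def_w; exact: heavy_mixed.
exists (blowup M (map majority W)); split.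
- move/MP; rewrite size_map => /(_ szW (2 * b)) Pblow.
  have Psmooth : P (smooth W).
    by apply: hP Pblow _ (smooth_subseq _) => v /WP/andP[].
  have := far _ _ Psmooth; rewrite size_smooth def_w => /(_ erefl).
  apply/negP; rewrite -leqNgt.
  have : hamming w (smooth W) <= k * q + size f * (2 * b).
    rewrite -def_w -szW; apply: leq_trans (@hamming_smooth q b W _) _.
      by move=> v /WP/andP[].
    by rewrite leq_add2l leq_mul2r (ltnW few) orbT.
  rewrite -(leq_pmul2l E_gt0) => /leq_trans; apply.
  have q_small : 2 * (E * (k * q)) <= n.
    apply: leq_trans le_qD; rewrite /D.
    have -> : q * (2 * k * E * M) = 2 * (E * (k * q)) * M by lia.
    exact: leq_pmulr.
  have b_small : 2 * (E * (size f * (2 * b))) <= n.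
    by apply: leq_trans le_kb; rewrite /k; nia.
  by rewrite mulnDr; lia.
- have size_blowup t : size (blowup M t) = size t * M.
    by elim: t => //= a t IHt; rewrite size_cat size_nseq IHt.
  by rewrite size_blowup size_map szW leq_addl.
- rewrite -def_w; apply: heavy_blowup => v /WP/andP[le_bv _].
  apply: leq_trans le_bv; rewrite leq_divRL //; apply: leq_trans le_qD.
  by rewrite /D; nia.
Qed.

(** * Distances and sampling probabilities *)

Local Open Scope ring_scope.

Lemma d1_hamming (R : realType) n (w u : n.-tuple bool) :
  d1 R w u = n%:R^-1 * (hamming w u)%:R.
Proof.
rewrite /d1 /hamming; congr (_ * _).
pose z : n.-tuple (bool * bool) := [tuple of zip w u].
rewrite -sum1_count natr_sum [RHS]big_mkcond /=.
rewrite -[zip w u]/(val z) big_tuple; apply: eq_bigr => i _.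
have -> : tnth z i = (tnth w i, tnth u i).
  by rewrite !(tnth_nth false) (tnth_nth (false, false)) nth_zip ?size_tuple.
case: (tnth w i) (tnth u i) => [] [] /=;
  by rewrite ?subrr ?subr0 ?sub0r ?normrN ?normr1 ?normr0.
Qed.

Lemma d1_property_le (R : realType) n (w u : n.-tuple bool) (P : word_property) :
  P u -> (d1_property R w P <= (d1 R w u)%:E)%E.
Proof. by move=> Pu; apply: bigmin_le_cond; apply/asboolP. Qed.

Lemma subword_subseq n (w : n.-tuple bool) (I : {set 'I_n}) :
  subseq (subword w I) w.
Proof.
rewrite /subword -[X in subseq _ X](map_tnth_enum w).
by apply: map_subseq; rewrite enumT; exact: filter_subseq.
Qed.

Lemma sub_probE (R : realType) l n (w : n.-tuple bool) (Q : word_property) :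
  sub_prob R l w Q =
  #|[set I : {set 'I_n} | (#|I| == l) && `[< Q (subword w I) >]]%SET|%:R
    / 'C(n, l)%:R.
Proof.
rewrite /sub_prob /uniform_prob card_draws card_ord; congr (_%:R / _).
by apply: eq_card => I; rewrite !inE.
Qed.

Lemma hereditary_completeness (R : realType) (P : word_property) :
  hereditary P -> completeness (1 : R) P P.
Proof.
move=> hP n w Pw l /andP[_ le_ln]; rewrite sub_probE.
rewrite (_ : #|_| = 'C(n, l)) ?divff // ?pnatr_eq0 -?lt0n ?bin_gt0 //.
rewrite -[in RHS](card_ord n) -card_draws; apply: eq_card => I; rewrite !inE.
case: (#|I| == l) => //=.
exact/asboolP/(hP _ Pw)/subword_subseq.
Qed.

(** In the constant [6], a factor [3] is for the probability [1 / 3] and a factor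
    [2] for rounding in [n %/ D]; the successor keeps [n] and [n %/ D]
    positive when [r] is [0]. *)
Lemma sub_prob_small (R : realType) (P : word_property) (g : word) r D l n
    (w : n.-tuple bool) :
  hereditary P -> ~ P g -> (size g <= r)%N -> (0 < D)%N ->
  heavy (n %/ D) g w -> (6 * r.+1 * D <= l <= n)%N ->
  sub_prob R l w P <= 1 / 3.
Proof.
move=> hP nPg le_gr D_gt0 hg /andP[le_l le_ln].
rewrite sub_probE ler_pdivrMr ?ltr0n ?bin_gt0 // mulrAC mul1r ler_pdivlMr //.
rewrite -natrM ler_nat.
set B := (X in (#|X| * 3)%N).
(* As [D <= n], the integer part loses at most a factor [2]. *)
have q_large : (n <= 2 * (D * (n %/ D)))%N.
  have : (0 < n %/ D)%N by rewrite divn_gt0 //; nia.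
  have := ltn_ceil n D_gt0; nia.
have n_gt0 : (0 < n)%N by nia.
have := card_miss l (leq_div n D) hg.
set B' := (X in (_ * #|X|)%N) => le_B'.
have BB' : (#|B| <= #|B'|)%N.
  apply/subset_leq_card/fintype.subsetP => I; rewrite !inE => /andP[-> /asboolP PI] /=.
  by apply/negP => /(hP _ PI).
have lq_large : (3 * r.+1 * n <= l * (n %/ D))%N.
  apply: leq_trans (_ : 6 * r.+1 * D * (n %/ D) <= _)%N; last first.
    by rewrite leq_mul2r le_l orbT.
  have -> : (6 * r.+1 * D * (n %/ D) = 3 * r.+1 * (2 * (D * (n %/ D))))%N by lia.
  by rewrite leq_mul2l q_large orbT.
have rn_gt0 : (0 < r.+1 * n)%N by rewrite muln_gt0.
rewrite -(leq_pmul2l rn_gt0).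
apply: leq_trans (_ : l * (n %/ D) * #|B'| <= _)%N.
  have -> : (r.+1 * n * (#|B| * 3) = 3 * r.+1 * n * #|B|)%N by lia.
  exact: leq_mul.
apply: leq_trans le_B' _; rewrite -mulnA leq_mul2r; apply/orP; right.
exact: leqW.
Qed.

(** * Testability *)

Theorem theorem4 (R : realType) (P : word_property) :
  hereditary P -> testable_perfect_completeness R P.
Proof.
move=> hP; exists P; split; first exact: hereditary_completeness.
move=> eps eps_gt0.
(* When [P] contains all words, no word is at positive distance from [P]. *)
have [allP|/existsNP[f nPf]] := pselect (forall f, P f).
  exists 1%N => // n w far; have := le_trans far (d1_property_le R w (allP w)).
  have -> : d1 R w w = 0.
    by rewrite /d1 big1 ?mulr0 // => i _; rewrite subrr normr0.
  by rewrite lee_fin leNgt eps_gt0.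
pose E := Num.bound eps^-1.
have ltE : eps^-1 < E%:R by apply: archi_boundP; rewrite invr_ge0 ltW.
have E_gt0 : (0 < E)%N by rewrite -(ltr0n R) (le_lt_trans _ ltE) // invr_ge0 ltW.
have [r [D [D_gt0 obs]]] := heavy_obstruction hP nPf E_gt0.
exists (6 * r.+1 * D)%N; first by rewrite !muln_gt0.
move=> n w far l l_range.
have le_Dn : (D <= n)%N by nia.
have n_gt0 : (0 < n)%N by apply: leq_trans le_Dn.
have [||g [nPg le_gr hg]] := obs w; rewrite ?size_tuple //; last first.
  move: hg; rewrite size_tuple => hg.
  exact: sub_prob_small hP nPg le_gr D_gt0 hg l_range.
move=> u /eqP szu Pu; pose u' : n.-tuple bool := Tuple szu.
have := le_trans far (d1_property_le R w (Pu : P u')).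
rewrite lee_fin d1_hamming mulrC ler_pdivlMr ?ltr0n // => le_ham.
rewrite -(ltr_nat R) natrM.
apply: lt_le_trans (_ : E%:R * (eps * n%:R) <= _); last by rewrite ler_pM2l ?ltr0n.
rewrite mulrA ltr_pMl ?ltr0n // -ltr_pdivrMr //.
by rewrite mul1r.
Qed.
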